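(* Let $B>0$. For the transmission-time minimization problem $\mathcal T$ for the single-user Gaussian channel with an energy harvesting source that has $B$ bits to send, the generalized lazy online algorithm GLO is $2$-competitive: for every energy arrival sequence $\boldsymbol\sigma$ with $\mathcal T_O(\boldsymbol\sigma)<\infty$, its completion time is at most $2\,\mathcal T_O(\boldsymbol\sigma)$.
   Context: All logarithms are base 2. Energy arrivals. An energy arrival sequence $\boldsymbol\sigma$ is a finite or infinite sequence of pairs $(t_i,E_i)$, $i=0,1,2,\dots$, with $0=t_0<t_1<t_2<\cdots$ (with $t_i\to\infty$ if the sequence is infinite) and $E_i>0$: the source receives energy $E_i$ at time $t_i$. The sequence is arbitrary (no distribution is assumed). Transmission. All $B$ bits are available at time $0$. The source uses a piecewise constant nonnegative transmit power $P(t)$, $t\ge 0$, with finitely many changes on any bounded time interval. Transmitting with constant power $P$ for a duration $T$ uses energy $PT$ and sends $T\log(1+P)$ bits. Thus by time $t$ the number of bits sent is $B(t)=\int_0^t\log(1+P(s))\,ds$ and the energy used is $E(t)=\int_0^t P(s)\,ds$. The power profile is feasible for $\boldsymbol\sigma$ if it satisfies energy neutrality: $E(t)\le\sum_{i:\,t_i\le t}E_i$ for all $t\ge0$. The completion time of a profile is the smallest $T$ with $B(T)=B$ ($+\infty$ if there is none). Problem $\mathcal T$. Minimize the completion time over feasible power profiles. $\mathcal T_O(\boldsymbol\sigma)$ denotes the minimum completion time over all power profiles feasible for $\boldsymbol\sigma$ (the optimal offline algorithm, which knows all of $\boldsymbol\sigma$ in advance; $+\infty$ if no feasible profile completes). Lazy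 online algorithm. At each energy arrival instant $t_i$ from its starting instant on, as long as transmission is not complete, let $\hat E_i$ be the available energy (all left over, i.e. harvested and not yet used, energy plus the new arrival $E_i$) and $\hat B_i$ the number of bits still to be transmitted. Find the minimum $T_i$ such that $T_i\log\left(1+\frac{\hat E_i}{T_i}\right)=\hat B_i$, and transmit with constant power $P_i=\hat E_i/T_i$ until the next energy arrival $t_{i+1}$ (or until all bits are sent, if this happens earlier or there is no further arrival). Generalized lazy online algorithm (GLO). At each energy arrival instant $t_n$ compute $B_s(n)=\lim_{T\to\infty}T\log\left(1+\frac{\sum_{i=0}^nE_i}{T}\right)$. If $B_s(n)\le B$, GLO transmits with zero power and waits until the next arrival instant. At the first $n$ with $B_s(n)>B$, GLO starts using the lazy online algorithm from time $t_n$ onwards, with all the energy harvested so far available and all $B$ bits still to be sent. The completion time of GLO is measured from time $0$. *)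

(* Defs.v *)
From Stdlib Require Export Reals.
From Stdlib Require Import ClassicalEpsilon.
From Coquelicot Require Export Coquelicot.

Open Scope R_scope.

Definition log2 (x : R) : R := ln x / ln 2.

(* [last = Some N] encodes a finite sequence with indices 0, ..., N, and
   [last = None] an infinite one. *)
Definition is_index (last : option nat) (i : nat) : bool :=
  match last with
  | Some N => Nat.leb i N
  | None => true
  end.

(* The values of [arr_time] and [arr_energy] at non-indices are irrelevant. *)
Record energy_arrivals : Type := EnergyArrivals {
  arr_last : option nat;
  arr_time : nat -> R;
  arr_energy : nat -> R;
  arr_time_0 : arr_time 0 = 0;
  arr_time_lt : forall i : nat,
    is_index arr_last (S i) = true -> arr_time i < arr_time (S i);
  arr_energy_pos : forall i : nat,
    is_index arr_last i = true -> 0 < arr_energy i;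
  arr_time_unbounded : arr_last = None -> is_lim_seq arr_time p_infty
}.

Definition arrival (sigma : energy_arrivals) (i : nat) : bool :=
  is_index (arr_last sigma) i.

(* The series has finitely many nonzero terms. *)
Definition harvested (sigma : energy_arrivals) (t : R) : R :=
  Series (fun i =>
    if arrival sigma i then
      if Rle_dec (arr_time sigma i) t then arr_energy sigma i else 0
    else 0).

(* [IsStepFun] lives in [Type] and asks for a finite subdivision of [0, T] with
   the function constant on each open piece. *)
Definition power_profile (P : R -> R) : Prop :=
  (forall t : R, 0 <= t -> 0 <= P t) /\
  (forall T : R, 0 <= T -> inhabited (IsStepFun P 0 T)).

Definition bits_sent (P : R -> R) (t : R) : R :=
  RInt (fun s => log2 (1 + P s)) 0 t.

Definition energy_used (P : R -> R) (t : R) : R := RInt P 0 t.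

Definition feasible (sigma : energy_arrivals) (P : R -> R) : Prop :=
  power_profile P /\
  forall t : R, 0 <= t -> energy_used P t <= harvested sigma t.

(* For a power profile [bits_sent P] is continuous, so the infimum is a minimum
   as soon as the set is nonempty; the infimum of the empty set is [p_infty]. *)
Definition completion_time (P : R -> R) (B : R) : Rbar :=
  Glb_Rbar (fun T => 0 <= T /\ bits_sent P T = B).

(* Taking the infimum avoids presupposing that an optimal profile exists; it is
   the minimum whenever one does, and [p_infty] if no feasible profile
   completes. *)
Definition offline_time (sigma : energy_arrivals) (B : R) : Rbar :=
  Glb_Rbar (fun T =>
    exists P : R -> R, feasible sigma P /\ completion_time P B = Finite T).

(* For e, b > 0 the equation has at most one solution, T |-> T log2 (1 + e / T)
   being strictly increasing, so the infimum is the least solution. *)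
Definition lazy_duration (e b : R) : R :=
  real (Glb_Rbar (fun T => 0 < T /\ T * log2 (1 + e / T) = b)).

(* Power of the lazy algorithm [s] time units after an arrival at which the
   available energy is [e] and [b] bits remain, before the next arrival. *)
Definition lazy_power (e b s : R) : R :=
  if Rlt_dec 0 b then
    if Rlt_dec s (lazy_duration e b) then e / lazy_duration e b else 0
  else 0.

(* Supremum, never attained, of the number of bits sendable with the energy of
   the arrivals 0, ..., n. *)
Definition sendable_bits (sigma : energy_arrivals) (n : nat) : Rbar :=
  Lim (fun T => T * log2 (1 + sum_f_R0 (arr_energy sigma) n / T)) p_infty.

Fixpoint glo_started (sigma : energy_arrivals) (B : R) (n : nat) : bool :=
  (if Rbar_lt_dec (Finite B) (sendable_bits sigma n) then true else false) ||
  match n with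
  | O => false
  | S m => glo_started sigma B m
  end.

Definition glo_slot_power (sigma : energy_arrivals) (B : R) (n : nat)
    (e b s : R) : R :=
  if glo_started sigma B n then lazy_power e b s else 0.

(* Available energy, including the new arrival, and number of bits still to be
   sent at the n-th arrival instant. *)
Fixpoint glo_state (sigma : energy_arrivals) (B : R) (n : nat) : R * R :=
  match n with
  | O => (arr_energy sigma 0, B)
  | S m =>
      let (e, b) := glo_state sigma B m in
      let p := glo_slot_power sigma B m e b in
      let d := arr_time sigma (S m) - arr_time sigma m in
      (e - energy_used p d + arr_energy sigma (S m), b - bits_sent p d)
  end.

(* For t >= 0 exactly one index satisfies the condition. *)
Definition last_arrival (sigma : energy_arrivals) (t : R) : nat :=
  epsilon (inhabits 0%nat) (fun n =>
    arrival sigma n = true /\ arr_time sigma n <= t /\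
    (arrival sigma (S n) = true -> t < arr_time sigma (S n))).

Definition glo_profile (sigma : energy_arrivals) (B : R) (t : R) : R :=
  let n := last_arrival sigma t in
  let (e, b) := glo_state sigma B n in
  glo_slot_power sigma B n e b (t - arr_time sigma n).

Definition glo_time (sigma : energy_arrivals) (B : R) : Rbar :=
  completion_time (glo_profile sigma B) B.

(* Main.v *)
(* Suppose some feasible profile sends [B] bits by time [T], and let [E] be the
   energy harvested up to [T], the last arrival being at [t_n <= T]. By concavity
   of the logarithm [B <= T log (1 + E / T)], so GLO has started by [t_n]. Its
   powers are nondecreasing and the efficiency [log (1 + p) / p] is decreasing, so
   if [p] is the power chosen at [t_n], then [B >= E log (1 + p) / p]. Hence
   [p >= E / T], which bounds the lazy duration chosen at [t_n] by [T]: the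
   planned completion time is at most [t_n + T <= 2 T], and later arrivals only
   bring it forward. *)

Require Import Defs.
From Stdlib Require Import Reals.
From Coquelicot Require Import Coquelicot.
From Stdlib Require Import Ranalysis5 Lra Lia Classical ClassicalEpsilon.

(** * Logarithm inequalities and energy efficiency *)

Lemma ln2_pos : 0 < ln 2.
Proof. rewrite <- ln_1; apply ln_increasing; lra. Qed.

(** Strict concavity of [ln], obtained from [1 + z < exp z] at [z = ln (y / x)], which is
    nonzero. *)
Lemma ln_lt_tangent (x y : R) :
  0 < x -> 0 < y -> x <> y -> ln y < ln x + (y - x) / x.
Proof.
  intros Hx Hy Hxy.
  assert (Hl : ln (y / x) <> 0).
  { intros H; apply Hxy.
    assert (E : y / x = 1).
    { apply ln_inv; [apply Rdiv_lt_0_compat | | rewrite ln_1]; lra. }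
    apply (f_equal (fun z => z * x)) in E; field_simplify in E; lra. }
  pose proof (exp_ineq1 _ Hl) as H.
  rewrite exp_ln in H by (apply Rdiv_lt_0_compat; lra).
  unfold Rdiv in H at 1; rewrite ln_mult, ln_Rinv in H; try lra.
  2: now apply Rinv_0_lt_compat.
  replace ((y - x) / x) with (y / x - 1) by (field; lra). lra.
Qed.

Lemma ln_le_tangent (x y : R) :
  0 < x -> 0 < y -> ln y <= ln x + (y - x) / x.
Proof.
  intros Hx Hy. destruct (Req_dec x y) as [<-|H].
  - unfold Rminus; rewrite Rplus_opp_r; unfold Rdiv; rewrite Rmult_0_l; lra.
  - apply Rlt_le, ln_lt_tangent; assumption.
Qed.

Lemma ln_lt_id (p : R) : 0 < p -> ln (1 + p) < p.
Proof.
  intros Hp. generalize (ln_lt_tangent 1 (1 + p)); rewrite ln_1.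
  replace ((1 + p - 1) / 1) with p by field. lra.
Qed.

(** The tangent to [ln] at [1 + p] lies strictly above [ln 1 = 0] at the point 1. *)
Lemma ln_gt_frac (p : R) : 0 < p -> p < (1 + p) * ln (1 + p).
Proof.
  intros Hp. assert (H := ln_lt_tangent (1 + p) 1); rewrite ln_1 in H.
  assert (H1 : 0 < ln (1 + p) + (1 - (1 + p)) / (1 + p)) by (apply H; lra).
  apply (Rmult_lt_compat_l (1 + p)) in H1; [|lra].
  field_simplify in H1; lra.
Qed.

Lemma log2_pos (p : R) : 0 < p -> 0 < log2 (1 + p).
Proof.
  intros Hp; apply Rdiv_lt_0_compat; [|apply ln2_pos].
  rewrite <- ln_1; apply ln_increasing; lra.
Qed.

Lemma log2_1_plus_0 : log2 (1 + 0) = 0.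
Proof. unfold log2; rewrite Rplus_0_r, ln_1; unfold Rdiv; ring. Qed.

Lemma log2_le (p q : R) : 0 <= p -> p <= q -> log2 (1 + p) <= log2 (1 + q).
Proof.
  intros Hp Hq; unfold log2, Rdiv; apply Rmult_le_compat_r.
  - apply Rlt_le, Rinv_0_lt_compat, ln2_pos.
  - destruct Hq as [Hq|<-]; [apply Rlt_le, ln_increasing|]; lra.
Qed.

(* Bits per unit of energy at power [p]. *)
Definition efficiency (p : R) : R := log2 (1 + p) / p.

Lemma efficiency_pos (p : R) : 0 < p -> 0 < efficiency p.
Proof. intros Hp; apply Rdiv_lt_0_compat; [apply log2_pos|]; lra. Qed.

(** The tangent at [1 + p] bounds [ln (1 + q)], and [ln_gt_frac] absorbs the slope term [w * p] into
    [(q - p) * ln (1 + p)]. *)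
Lemma efficiency_lt (p q : R) : 0 < p -> p < q -> efficiency q < efficiency p.
Proof.
  intros Hp Hq. assert (H2 := ln2_pos).
  assert (H : p * ln (1 + q) < q * ln (1 + p)).
  { assert (H := ln_lt_tangent (1 + p) (1 + q) ltac:(lra) ltac:(lra) ltac:(lra)).
    assert (H' := ln_gt_frac p Hp).
    replace ((1 + q - (1 + p)) / (1 + p)) with ((q - p) / (1 + p)) in H by (f_equal; ring).
    set (w := (q - p) / (1 + p)) in *.
    assert (Ew : w * (1 + p) = q - p) by (unfold w; field; lra).
    assert (Hw : 0 < w) by (apply Rdiv_lt_0_compat; lra).
    assert (p * ln (1 + q) < p * (ln (1 + p) + w)) by (apply Rmult_lt_compat_l; lra).
    assert (w * p < w * ((1 + p) * ln (1 + p))) by (apply Rmult_lt_compat_l; lra).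
    rewrite <- Rmult_assoc, Ew in *. lra. }
  unfold efficiency, log2.
  apply (Rmult_lt_reg_r (p * q * ln 2)).
  - repeat apply Rmult_lt_0_compat; lra.
  - field_simplify; lra.
Qed.

Lemma efficiency_le_inv (p q : R) :
  0 < p -> 0 < q -> efficiency p <= efficiency q -> q <= p.
Proof.
  intros Hp Hq H. destruct (Rle_lt_dec q p) as [|Hl]; [assumption|].
  assert (H' := efficiency_lt p q Hp Hl); lra.
Qed.

(** The bound is the limit of the efficiency as the power tends to 0. *)
Lemma efficiency_lt_inv_ln2 (p : R) : 0 < p -> efficiency p < / ln 2.
Proof.
  intros Hp. assert (H := ln_lt_id p Hp). assert (H2 := ln2_pos).
  unfold efficiency, log2. apply (Rmult_lt_reg_r (p * ln 2)).
  - apply Rmult_lt_0_compat; lra.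
  - field_simplify; lra.
Qed.

Lemma exists_efficiency (c : R) :
  0 < c -> c < / ln 2 -> exists p, 0 < p /\ efficiency p = c.
Proof.
  intros Hc Hc2. assert (H2 := ln2_pos).
  set (k := c * ln 2).
  assert (Hk0 : 0 < k) by (apply Rmult_lt_0_compat; lra).
  assert (Hk1 : k < 1).
  { unfold k; apply (Rmult_lt_compat_r (ln 2)) in Hc2; [|lra].
    rewrite Rinv_l in Hc2; lra. }
  (* [p1] minimizes [k * p - ln (1 + p)]: the derivative [k - 1 / (1 + p)] vanishes there, and the
     value is negative. *)
  set (p1 := / k - 1).
  assert (Hik : 1 < / k) by (rewrite <- Rinv_1; apply Rinv_lt_contravar; lra).
  assert (Ek : k * / k = 1) by (field; lra).
  assert (Hp1 : 0 < p1) by (unfold p1; lra).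
  (* [p2] is large enough for the tangent to [ln] at [2 / k], of slope only [k / 2], to show
     [ln (1 + p2) < k * p2]. *)
  set (p2 := p1 + 2 * (ln (2 * / k) + 1) * / k).
  assert (Hl : 0 < ln (2 * / k)) by (rewrite <- ln_1; apply ln_increasing; lra).
  assert (Hp2 : p1 < p2).
  { unfold p2. assert (0 < 2 * (ln (2 * / k) + 1) * / k); [|lra].
    repeat apply Rmult_lt_0_compat; lra. }
  assert (F1 : k * p1 < ln (1 + p1)).
  { assert (H := ln_gt_frac p1 Hp1). apply (Rmult_lt_compat_l k) in H; [|lra].
    replace (1 + p1) with (/ k) in * by (unfold p1; ring).
    rewrite <- Rmult_assoc, Ek in H. lra. }
  assert (F2 : ln (1 + p2) < k * p2).
  { assert (H := ln_le_tangent (2 * / k) (1 + p2) ltac:(lra) ltac:(lra)).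
    replace ((1 + p2 - 2 * / k) / (2 * / k)) with (k * (1 + p2) / 2 - 1) in H
      by (field; lra).
    assert (k * p2 = k * p1 + 2 * (ln (2 * / k) + 1)).
    { unfold p2. rewrite Rmult_plus_distr_l. f_equal. field; lra. }
    assert (0 < k * p1) by (apply Rmult_lt_0_compat; lra). lra. }
  destruct (IVT_interv (fun p => k * p - ln (1 + p)) p1 p2) as [p [Hp E]];
    try lra.
  - intros p Hp. apply derivable_continuous_pt.
    apply ex_derive_Reals_0. auto_derive. lra.
  - exists p. split; [lra|]. unfold efficiency, log2.
    replace (ln (1 + p)) with (k * p) by lra. unfold k; field; lra.
Qed.

(** * The lazy duration and the number of sendable bits *)

Lemma transmission_eq_efficiency (e T : R) :
  0 < e -> 0 < T -> T * log2 (1 + e / T) = e * efficiency (e / T).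
Proof. intros He HT. unfold efficiency. field. lra. Qed.

(** The condition [b < e / ln 2] makes [b / e] the efficiency of some power [p]. Then [e / p] solves
    the lazy equation, and monotonicity of the efficiency makes it the least solution, so the
    infimum is attained. *)
Lemma lazy_duration_spec (e b : R) :
  0 < e -> 0 < b -> b < e / ln 2 ->
  0 < lazy_duration e b /\ e * efficiency (e / lazy_duration e b) = b.
Proof.
  intros He Hb Hbe. assert (H2 := ln2_pos).
  destruct (exists_efficiency (b / e)) as [p [Hp Ep]].
  { apply Rdiv_lt_0_compat; lra. }
  { apply (Rmult_lt_reg_r e); [lra|]. field_simplify; lra. }
  assert (HD : 0 < e / p) by (apply Rdiv_lt_0_compat; lra).
  assert (EeD : e / (e / p) = p) by (field; lra).
  enough (E : lazy_duration e b = e / p).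
  { rewrite E, EeD, Ep. split; [assumption|field; lra]. }
  unfold lazy_duration. rewrite (is_glb_Rbar_unique _ (Finite (e / p))); [easy|].
  split.
  - intros T [HT ET]. rewrite transmission_eq_efficiency in ET by assumption.
    assert (Hq : 0 < e / T) by (apply Rdiv_lt_0_compat; lra).
    assert (Hle : e / T <= p).
    { apply efficiency_le_inv; try assumption. rewrite Ep, <- ET. right; field; lra. }
    simpl. apply (Rmult_le_compat_r (T / p)) in Hle.
    + replace (e / T * (T / p)) with (e / p) in Hle by (field; lra).
      replace (p * (T / p)) with T in Hle by (field; lra). assumption.
    + apply Rlt_le, Rdiv_lt_0_compat; lra.
  - intros l Hl. apply Hl. split; [assumption|].
    rewrite transmission_eq_efficiency, EeD, Ep by assumption. field; lra.
Qed.

(** If the equation has no solution, the infimum is [p_infty], which [real] sends to 0; otherwise 0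
    is a lower bound of the solutions. *)
Lemma lazy_duration_nonneg (e b : R) : 0 <= lazy_duration e b.
Proof.
  unfold lazy_duration.
  destruct (Glb_Rbar_correct (fun T => 0 < T /\ T * log2 (1 + e / T) = b)) as [_ H].
  assert (H0 := H (Finite 0)).
  destruct (Glb_Rbar _) as [x| |]; simpl in *; try lra.
  apply H0. intros T [HT _]. simpl; lra.
Qed.

(** Squeeze by [p / (1 + p) < ln (1 + p) < p] with [p = S / T], which tends to 0. *)
Lemma sendable_bits_eq (sigma : energy_arrivals) (n : nat) :
  0 < sum_f_R0 (arr_energy sigma) n ->
  sendable_bits sigma n = Finite (sum_f_R0 (arr_energy sigma) n / ln 2).
Proof.
  unfold sendable_bits. set (S := sum_f_R0 _ n). intros HS.
  assert (H2 := ln2_pos).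
  apply is_lim_unique.
  apply (is_lim_le_le_loc (fun T => S / ln 2 * / (1 + S * / T)) (fun _ => S / ln 2)).
  - exists 0. intros T HT.
    assert (Hp : 0 < S / T) by (apply Rdiv_lt_0_compat; lra).
    assert (H := ln_lt_id _ Hp). assert (H' := ln_gt_frac _ Hp).
    replace (S / ln 2) with (T * (S / T / ln 2)) by (field; lra).
    rewrite Rmult_assoc. unfold log2.
    split; apply Rmult_le_compat_l; try lra.
    + change (S * / T) with (S / T).
      apply (Rmult_le_reg_r (ln 2 * (1 + S / T))).
      * apply Rmult_lt_0_compat; lra.
      * replace (S / T / ln 2 * / (1 + S / T) * (ln 2 * (1 + S / T)))
          with (S / T) by (field; lra).
        replace (ln (1 + S / T) / ln 2 * (ln 2 * (1 + S / T)))
          with ((1 + S / T) * ln (1 + S / T)) by (field; lra). lra.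
    + apply Rmult_le_compat_r; [apply Rlt_le, Rinv_0_lt_compat|]; lra.
  - assert (H0 : is_lim (fun T => S * / T) p_infty 0).
    { evar_last.
      - apply (is_lim_mult (fun _ => S) (fun T => / T) p_infty S 0);
          [apply is_lim_const| |exact I].
        apply (is_lim_inv (fun T => T) p_infty p_infty); [apply is_lim_id|easy].
      - simpl; f_equal; ring. }
    evar_last.
    + apply (is_lim_mult (fun _ => S / ln 2) (fun T => / (1 + S * / T)) p_infty
        (S / ln 2) (Rbar_inv (1 + 0))); [apply is_lim_const| |exact I].
      apply (is_lim_inv (fun T => 1 + S * / T) p_infty (1 + 0)).
      * apply (is_lim_plus (fun _ => 1) (fun T => S * / T) p_infty 1 0);
          [apply is_lim_const|exact H0|easy].
      * simpl; intros E; injection E; lra.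
    + simpl; f_equal; field; lra.
  - apply is_lim_const.
Qed.

(** * Integrals of step powers, the concavity bound and finite series *)

Lemma IsStepFun_comp (f g : R -> R) (a b : R) :
  IsStepFun f a b -> IsStepFun (fun x => g (f x)) a b.
Proof.
  intros [l [lf (H1 & H2 & H3 & H4 & H5)]].
  exists l, (List.map g lf). repeat split; try assumption.
  - now rewrite List.length_map.
  - intros i Hi x Hx. rewrite (H5 i Hi x Hx).
    rewrite H4 in Hi; simpl in Hi. clear - Hi.
    revert i Hi; induction lf as [|y lf IH]; intros i Hi; simpl in *; [lia|].
    destruct i; [easy|]. apply IH; lia.
Qed.

(** A step function approximates itself, with the zero function as error bound. *)
Lemma ex_RInt_step (f : R -> R) (a b : R) : IsStepFun f a b -> ex_RInt f a b.
Proof.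
  intros Hf. apply ex_RInt_Reals_1. intros eps.
  exists (mkStepFun Hf), (mkStepFun (StepFun_P4 a b 0)). split.
  - intros t _. simpl. unfold fct_cte. rewrite Rminus_diag, Rabs_R0. lra.
  - rewrite StepFun_P18, Rmult_0_l, Rabs_R0. apply cond_pos.
Qed.

(** Serves for energy with [F] the identity and for bits with [F x = log2 (1 + x)]. *)
Lemma is_RInt_threshold (F : R -> R) (p D d : R) :
  0 <= D -> 0 <= d ->
  is_RInt (fun s => F (if Rlt_dec s D then p else 0)) 0 d
    (Rmin d D * F p + (d - Rmin d D) * F 0).
Proof.
  intros HD Hd.
  assert (Hm : 0 <= Rmin d D) by (apply Rmin_glb; assumption).
  assert (Hmd := Rmin_l d D). assert (HmD := Rmin_r d D).
  apply (is_RInt_Chasles _ 0 (Rmin d D) d (Rmin d D * F p) ((d - Rmin d D) * F 0)).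
  - apply (is_RInt_ext (fun _ => F p)).
    + intros x Hx. rewrite Rmin_left, Rmax_right in Hx by assumption.
      destruct (Rlt_dec x D); [easy|lra].
    + generalize (is_RInt_const 0 (Rmin d D) (F p)). now rewrite Rminus_0_r.
  - apply (is_RInt_ext (fun _ => F 0)).
    + intros x. rewrite Rmin_left, Rmax_right by assumption. intros Hx.
      destruct (Rlt_dec x D); [|easy].
      unfold Rmin in Hx; destruct (Rle_dec d D); lra.
    + apply (is_RInt_const (Rmin d D) d (F 0)).
Qed.

(** Jensen's inequality: [log2 (1 + P s)] is replaced by its tangent at the mean power [m = E / T],
    which integrates to at most [T * log2 (1 + m)] since the energy is at most [m * T]. *)
Lemma bits_sent_le (P : R -> R) (T E : R) :
  power_profile P -> 0 < T -> 0 < E -> energy_used P T <= E ->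
  bits_sent P T <= T * log2 (1 + E / T).
Proof.
  intros [HP Hs] HT HE HEu. assert (H2 := ln2_pos).
  destruct (Hs T (Rlt_le _ _ HT)) as [Hst].
  set (m := E / T). assert (Hm : 0 < m) by (apply Rdiv_lt_0_compat; lra).
  (* [c] is the derivative of [log2 (1 + x)] at [m]. *)
  set (c := / ((1 + m) * ln 2)).
  assert (Hc : 0 < c) by (apply Rinv_0_lt_compat, Rmult_lt_0_compat; lra).
  assert (HPi : is_RInt P 0 T (energy_used P T))
    by (apply (RInt_correct (V := R_CompleteNormedModule)), ex_RInt_step, Hst).
  assert (Htan : is_RInt (fun s => (log2 (1 + m) - c * m) + c * P s) 0 T
    (T * (log2 (1 + m) - c * m) + c * energy_used P T)).
  { apply (is_RInt_plus (V := R_NormedModule) (fun _ => log2 (1 + m) - c * m)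
      (fun s => c * P s)).
    - generalize (is_RInt_const 0 T (log2 (1 + m) - c * m)). now rewrite Rminus_0_r.
    - apply (is_RInt_scal (V := R_NormedModule)), HPi. }
  apply Rle_trans with (T * (log2 (1 + m) - c * m) + c * energy_used P T).
  - rewrite <- (is_RInt_unique _ _ _ _ Htan).
    apply RInt_le; [lra| |eexists; exact Htan|].
    + apply ex_RInt_step, (IsStepFun_comp P (fun x => log2 (1 + x))), Hst.
    + intros s Hs'. assert (HPs := HP s ltac:(lra)).
      assert (H := ln_le_tangent (1 + m) (1 + P s) ltac:(lra) ltac:(lra)).
      apply (Rmult_le_compat_r (/ ln 2)) in H;
        [|apply Rlt_le, Rinv_0_lt_compat; lra].
      apply (Rle_trans _ _ _ H). right. unfold log2, c. field. lra.
  - apply (Rmult_le_compat_l c) in HEu; [|lra].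
    replace E with (m * T) in HEu by (unfold m; field; lra). lra.
Qed.

Lemma Series_finite (a : nat -> R) (n : nat) :
  (forall i, (n < i)%nat -> a i = 0) -> Series a = sum_f_R0 a n.
Proof.
  intros Ha. apply is_series_unique.
  change (is_lim_seq (sum_n a) (sum_f_R0 a n)).
  apply (is_lim_seq_ext_loc (fun _ => sum_f_R0 a n)); [|apply is_lim_seq_const].
  exists n. intros k Hk. rewrite sum_n_Reals.
  induction Hk as [|k Hk IH]; [easy|].
  simpl. rewrite <- IH, Ha by lia. ring.
Qed.

(** * The lazy algorithm between two arrivals *)

Lemma energy_used_lazy_power (e b d : R) :
  0 < b -> 0 <= d ->
  energy_used (lazy_power e b) d
  = Rmin d (lazy_duration e b) * (e / lazy_duration e b).
Proof.
  intros Hb Hd. apply is_RInt_unique. unfold lazy_power.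
  destruct (Rlt_dec 0 b); [|lra].
  evar_last.
  - apply (is_RInt_threshold (fun x => x)); [apply lazy_duration_nonneg|exact Hd].
  - ring.
Qed.

Lemma bits_sent_lazy_power (e b d : R) :
  0 < b -> 0 <= d ->
  bits_sent (lazy_power e b) d
  = Rmin d (lazy_duration e b) * log2 (1 + e / lazy_duration e b).
Proof.
  intros Hb Hd. apply is_RInt_unique. unfold lazy_power.
  destruct (Rlt_dec 0 b); [|lra].
  evar_last.
  - apply (is_RInt_threshold (fun x => log2 (1 + x)));
      [apply lazy_duration_nonneg|exact Hd].
  - rewrite log2_1_plus_0; ring.
Qed.

(* A new arrival can only raise the lazy power and bring the planned completion
   time forward. *)
Lemma lazy_power_step (e b d h : R) :
  0 < e -> 0 < b -> b < e / ln 2 -> 0 < d -> 0 < h ->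
  let D := lazy_duration e b in
  let e' := e - energy_used (lazy_power e b) d + h in
  let b' := b - bits_sent (lazy_power e b) d in
  0 < e' /\ 0 <= b' /\ b' < e' / ln 2 /\ e' <= e + h /\
  (0 < b' ->
    d < D /\ d + lazy_duration e' b' <= D /\
    e / D <= e' / lazy_duration e' b').
Proof.
  intros He Hb Hbe Hd Hh D e' b'. assert (H2 := ln2_pos).
  destruct (lazy_duration_spec e b He Hb Hbe) as [HD ED].
  fold D in HD, ED. rewrite <- transmission_eq_efficiency in ED by assumption.
  assert (He' := energy_used_lazy_power e b d Hb (Rlt_le _ _ Hd)).
  assert (Hb' := bits_sent_lazy_power e b d Hb (Rlt_le _ _ Hd)).
  fold D in He', Hb'.
  set (p := e / D) in *. assert (Hp : 0 < p) by (apply Rdiv_lt_0_compat; lra).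
  assert (Ee : e = D * p) by (unfold p; field; lra).
  (* If the plan ends within the slot, no bits remain and the available energy is just the new
     arrival [h]. *)
  destruct (Rle_lt_dec D d) as [HDd|HDd].
  - rewrite Rmin_right in He', Hb' by assumption.
    assert (e' = h) by (unfold e'; lra). assert (b' = 0) by (unfold b'; lra).
    assert (0 < e' / ln 2) by (apply Rdiv_lt_0_compat; lra).
    repeat split; lra.
  - rewrite Rmin_left in He', Hb' by lra.
    assert (Hdp : 0 < d * p) by (apply Rmult_lt_0_compat; lra).
    assert (Hr : 0 < (D - d) * p) by (apply Rmult_lt_0_compat; lra).
    assert (Hl := log2_pos p Hp).
    assert (Ee' : e' = (D - d) * p + h) by (unfold e'; lra).
    assert (Eb' : b' = (D - d) * log2 (1 + p)) by (unfold b'; lra).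
    (* Without [h] the leftover energy would send the remaining bits exactly at power [p]; with [h]
       a strictly lower efficiency suffices, so the new power is at least [p]. *)
    assert (Eb'' : b' = (e' - h) * efficiency p).
    { rewrite Ee', Eb'. unfold efficiency. field. lra. }
    assert (Hb'0 : 0 < b') by (rewrite Eb'; apply Rmult_lt_0_compat; lra).
    assert (Hf := efficiency_lt_inv_ln2 p Hp). assert (Hf0 := efficiency_pos p Hp).
    assert (Hlt : b' < e' * efficiency p).
    { rewrite Eb''. apply Rmult_lt_compat_r; lra. }
    assert (Hlt2 : b' < e' / ln 2).
    { apply (Rlt_trans _ _ _ Hlt). apply Rmult_lt_compat_l; lra. }
    split; [lra|]. split; [lra|]. split; [lra|]. split; [lra|]. intros _.
    assert (He'0 : 0 < e') by lra.
    destruct (lazy_duration_spec e' b' He'0 Hb'0 Hlt2) as [HD' ED'].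
    set (D' := lazy_duration e' b') in *.
    assert (Hp' : 0 < e' / D') by (apply Rdiv_lt_0_compat; lra).
    assert (Hpp : p <= e' / D').
    { apply efficiency_le_inv; [assumption..|].
      apply (Rmult_le_reg_l e'); lra. }
    split; [lra|]. split; [|assumption].
    (* Both plans send the remaining bits: [D' * log2 (1 + p) <= b' = (D - d) * log2 (1 + p)]. *)
    rewrite <- transmission_eq_efficiency, Eb' in ED' by assumption.
    assert (Hll := log2_le p (e' / D') (Rlt_le _ _ Hp) Hpp).
    apply (Rmult_le_compat_l D') in Hll; [|lra].
    enough (D' <= D - d) by lra.
    apply (Rmult_le_reg_r (log2 (1 + p))); lra.
Qed.

(** * Order of the arrivals and harvested energy *)

Definition total_energy (sigma : energy_arrivals) (n : nat) : R :=
  sum_f_R0 (arr_energy sigma) n.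

Lemma arrival_le (sigma : energy_arrivals) (i j : nat) :
  (i <= j)%nat -> arrival sigma j = true -> arrival sigma i = true.
Proof.
  unfold arrival, is_index. destruct (arr_last sigma); [|easy].
  rewrite !PeanoNat.Nat.leb_le. lia.
Qed.

Lemma arr_time_le (sigma : energy_arrivals) (i j : nat) :
  (i <= j)%nat -> arrival sigma j = true -> arr_time sigma i <= arr_time sigma j.
Proof.
  induction 1 as [|j Hij IH]; intros Hj; [lra|].
  assert (H := arr_time_lt sigma j Hj).
  assert (H' := IH (arrival_le sigma j (S j) ltac:(lia) Hj)). lra.
Qed.

Lemma arr_time_nonneg (sigma : energy_arrivals) (i : nat) :
  arrival sigma i = true -> 0 <= arr_time sigma i.
Proof.
  intros Hi. rewrite <- (arr_time_0 sigma). apply arr_time_le; [lia|assumption].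
Qed.

Lemma total_energy_pos (sigma : energy_arrivals) (n : nat) :
  arrival sigma n = true -> 0 < total_energy sigma n.
Proof.
  unfold total_energy. induction n as [|n IH]; intros Hn; simpl.
  - now apply arr_energy_pos.
  - apply Rplus_lt_0_compat; [|now apply arr_energy_pos].
    apply IH, (arrival_le sigma n (S n)); [lia|assumption].
Qed.

(** The property under the [epsilon] of [last_arrival], named so that existence and uniqueness can
    be shown for it. *)
Definition is_last_arrival (sigma : energy_arrivals) (t : R) (n : nat) : Prop :=
  arrival sigma n = true /\ arr_time sigma n <= t /\
  (arrival sigma (S n) = true -> t < arr_time sigma (S n)).

Lemma is_last_arrival_max (sigma : energy_arrivals) (t : R) (m n : nat) :
  is_last_arrival sigma t n -> arrival sigma m = true -> arr_time sigma m <= t ->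
  (m <= n)%nat.
Proof.
  intros (Hn & Hnt & Hn') Hm Hmt.
  destruct (PeanoNat.Nat.le_gt_cases m n) as [|Hlt]; [assumption|].
  assert (Hsn := arrival_le sigma (S n) m Hlt Hm).
  assert (H := arr_time_le sigma (S n) m Hlt Hm). specialize (Hn' Hsn). lra.
Qed.

Lemma exists_last_arrival (sigma : energy_arrivals) (t : R) :
  0 <= t -> exists n, is_last_arrival sigma t n.
Proof.
  intros Ht.
  (* Some index fails: one past the end of a finite sequence, or a late one of an infinite sequence,
     whose times are unbounded. Descending from it must meet a success, since index 0 succeeds. *)
  assert (H : exists m, ~ (arrival sigma m = true /\ arr_time sigma m <= t)).
  { unfold arrival, is_index. destruct (arr_last sigma) as [N|] eqn:EN.
    - exists (S N). rewrite PeanoNat.Nat.leb_le. lia.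
    - destruct (proj2 (is_lim_seq_spec _ _) (arr_time_unbounded sigma EN) t) as [m Hm].
      exists m. intros [_ H]. specialize (Hm m (le_n m)). lra. }
  destruct H as [m Hm]. induction m as [|m IH].
  - exfalso; apply Hm. rewrite arr_time_0. split; [|assumption].
    unfold arrival, is_index. now destruct (arr_last sigma).
  - destruct (classic (arrival sigma m = true /\ arr_time sigma m <= t)) as [H|H];
      [|now apply IH].
    exists m. split; [apply H|]. split; [apply H|]. intros Hs.
    apply Rnot_le_lt. intros Hle. now apply Hm.
Qed.

Lemma last_arrival_eq (sigma : energy_arrivals) (t : R) (n : nat) :
  is_last_arrival sigma t n -> last_arrival sigma t = n.
Proof.
  intros Hn.
  assert (H := epsilon_spec (inhabits 0%nat) (is_last_arrival sigma t)
    (ex_intro _ n Hn)).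
  change (epsilon _ _) with (last_arrival sigma t) in H.
  apply PeanoNat.Nat.le_antisymm; eapply is_last_arrival_max; eauto;
    solve [apply H | apply Hn].
Qed.

Lemma harvested_eq (sigma : energy_arrivals) (t : R) (n : nat) :
  is_last_arrival sigma t n -> harvested sigma t = total_energy sigma n.
Proof.
  intros Hn. unfold harvested. rewrite (Series_finite _ n).
  - apply sum_eq. intros i Hi.
    rewrite (arrival_le sigma i n) by (try assumption; apply Hn).
    assert (H := arr_time_le sigma i n Hi (proj1 Hn)).
    destruct Hn as (_ & Hnt & _).
    destruct (Rle_dec (arr_time sigma i) t); [easy|lra].
  - intros i Hi. destruct (arrival sigma i) eqn:Ei; [|easy].
    destruct (Rle_dec (arr_time sigma i) t) as [Hit|]; [|easy].
    assert (H := is_last_arrival_max sigma t i n Hn Ei Hit). lia.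
Qed.

(** * The invariant of GLO at arrival instants *)

(** Once GLO has started, [b < e / ln 2] keeps the lazy equation solvable, and the last inequality
    says that the energy spent so far was used at least as efficiently as the present power would
    use it. Before the start nothing has been spent. *)
Definition glo_invariant (sigma : energy_arrivals) (B : R) (k : nat) (e b : R) : Prop :=
  0 < e /\ 0 <= b /\ e <= total_energy sigma k /\
  if glo_started sigma B k then
    b < e / ln 2 /\
    (0 < b ->
      (total_energy sigma k - e) * efficiency (e / lazy_duration e b) <= B - b)
  else e = total_energy sigma k /\ b = B.

(** Covers both waiting and the starting instant itself, where the start test is exactly
    [b < e / ln 2] and the spent energy is 0. *)
Lemma glo_invariant_unused (sigma : energy_arrivals) (B : R) (k : nat) :
  0 < B -> arrival sigma k = true ->
  (forall m, S m = k -> glo_started sigma B m = false) ->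
  glo_invariant sigma B k (total_energy sigma k) B.
Proof.
  intros HB Hk Hm. assert (HS := total_energy_pos sigma k Hk).
  split; [assumption|]. split; [lra|]. split; [lra|].
  destruct (glo_started sigma B k) eqn:Es; [|easy].
  split.
  - assert (Hs : Rbar_lt B (sendable_bits sigma k)).
    { destruct k as [|m]; cbn [glo_started] in Es; [|rewrite (Hm m eq_refl) in Es];
        destruct (Rbar_lt_dec B _); easy. }
    rewrite sendable_bits_eq in Hs by assumption. exact Hs.
  - intros _. rewrite !Rminus_diag. lra.
Qed.

Lemma glo_state_invariant (sigma : energy_arrivals) (B : R) (k : nat) :
  0 < B -> arrival sigma k = true ->
  let (e, b) := glo_state sigma B k in glo_invariant sigma B k e b.
Proof.
  intros HB. induction k as [|k IH]; intros Hk.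
  - now apply (glo_invariant_unused sigma B 0).
  - specialize (IH (arrival_le sigma k (S k) ltac:(lia) Hk)).
    cbn [glo_state]. destruct (glo_state sigma B k) as [e b].
    set (d := arr_time sigma (S k) - arr_time sigma k).
    assert (Hd : 0 < d) by (generalize (arr_time_lt sigma k Hk); unfold d; lra).
    assert (Hh := arr_energy_pos sigma (S k) Hk).
    set (h := arr_energy sigma (S k)) in *.
    assert (ES : total_energy sigma (S k) = total_energy sigma k + h) by easy.
    destruct IH as (He & Hb & HeS & IH).
    unfold glo_slot_power. destruct (glo_started sigma B k) eqn:Es.
    + assert (Es' : glo_started sigma B (S k) = true)
        by (cbn [glo_started]; rewrite Es; apply Bool.orb_true_r).
      unfold glo_invariant; rewrite Es', ES.
      destruct IH as [Hbe IH].
      destruct (Rle_lt_or_eq_dec 0 b Hb) as [Hb0|<-].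
      * destruct (lazy_power_step e b d h He Hb0 Hbe Hd Hh)
          as (He' & Hb' & Hbe' & Heh & Hstep).
        assert (Eu := energy_used_lazy_power e b d Hb0 (Rlt_le _ _ Hd)).
        assert (Eb := bits_sent_lazy_power e b d Hb0 (Rlt_le _ _ Hd)).
        cbv zeta in Hstep.
        set (e' := e - energy_used (lazy_power e b) d + h) in *.
        set (b' := b - bits_sent (lazy_power e b) d) in *.
        do 2 (split; [assumption|]). split; [lra|]. split; [assumption|].
        intros Hb'0. destruct (Hstep Hb'0) as (HdD & _ & Hpp).
        specialize (IH Hb0).
        destruct (lazy_duration_spec e b He Hb0 Hbe) as [HD _].
        set (p := e / lazy_duration e b) in *.
        assert (Hp : 0 < p) by (apply Rdiv_lt_0_compat; lra).
        rewrite Rmin_left in Eu, Eb by lra.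
        replace (log2 (1 + p)) with (p * efficiency p) in Eb
          by (unfold efficiency; field; lra).
        set (p' := e' / lazy_duration e' b') in *.
        assert (Hff : efficiency p' <= efficiency p).
        { destruct Hpp as [Hpp|<-]; [|lra]. apply Rlt_le, efficiency_lt; lra. }
        assert (Hdp : 0 < d * p) by (apply Rmult_lt_0_compat; lra).
        (* The slot spends [d * p] at efficiency [efficiency p], and the new power [p'] is no more
           efficient than [p]. *)
        apply Rle_trans with ((total_energy sigma k - e + d * p) * efficiency p).
        -- replace (total_energy sigma k + h - e')
             with (total_energy sigma k - e + d * p) by (unfold e'; lra).
           apply Rmult_le_compat_l; lra.
        -- unfold b'. lra.
      (* Transmission is already complete: the power is zero and the energy only accumulates. *)
      * assert (Elazy : forall s, lazy_power e 0 s = 0).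
        { intros s; unfold lazy_power. destruct (Rlt_dec 0 0); [lra|easy]. }
        unfold energy_used, bits_sent.
        rewrite (RInt_ext _ (fun _ => 0)) by (intros; apply Elazy).
        rewrite (RInt_ext (fun s => log2 _) (fun _ => 0))
          by (intros; rewrite Elazy; apply log2_1_plus_0).
        rewrite RInt_const; unfold scal; simpl; unfold mult; simpl.
        rewrite Rmult_0_r.
        assert (0 < (e - 0 + h) / ln 2)
          by (apply Rdiv_lt_0_compat; [lra|apply ln2_pos]).
        repeat split; lra.
    + destruct IH as [-> ->].
      unfold energy_used, bits_sent.
      rewrite (RInt_ext (fun s => log2 _) (fun _ => 0))
        by (intros; apply log2_1_plus_0).
      rewrite !RInt_const; unfold scal; simpl; unfold mult; simpl.
      rewrite Rmult_0_r, !Rminus_0_r, <- ES.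
      apply glo_invariant_unused; [assumption..|].
      now intros m [= ->].
Qed.

(** * Bits sent by the GLO profile *)

Lemma is_RInt_glo_slot_bits (sigma : energy_arrivals) (B : R) (n : nat) (e b d : R) :
  0 <= d ->
  is_RInt (fun s => log2 (1 + glo_slot_power sigma B n e b s)) 0 d
    (bits_sent (glo_slot_power sigma B n e b) d).
Proof.
  intros Hd. apply (RInt_correct (V := R_CompleteNormedModule)).
  unfold glo_slot_power, lazy_power.
  destruct (glo_started sigma B n); [destruct (Rlt_dec 0 b)|].
  - eexists. apply (is_RInt_threshold (fun x => log2 (1 + x)));
      [apply lazy_duration_nonneg|exact Hd].
  - apply ex_RInt_const.
  - apply ex_RInt_const.
Qed.

(** A time shift of the slot power. The endpoint [t] may be the next arrival instant, because the
    integrands need to agree only on the open interval. *)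
Lemma is_RInt_glo_profile_slot (sigma : energy_arrivals) (B : R) (n : nat) (t : R) :
  arrival sigma n = true -> arr_time sigma n <= t ->
  (arrival sigma (S n) = true -> t <= arr_time sigma (S n)) ->
  let (e, b) := glo_state sigma B n in
  is_RInt (fun s => log2 (1 + glo_profile sigma B s)) (arr_time sigma n) t
    (bits_sent (glo_slot_power sigma B n e b) (t - arr_time sigma n)).
Proof.
  intros Hn Hnt Hn'. destruct (glo_state sigma B n) as [e b] eqn:E.
  assert (H := is_RInt_glo_slot_bits sigma B n e b (t - arr_time sigma n) ltac:(lra)).
  replace 0 with (1 * arr_time sigma n + - arr_time sigma n) in H by ring.
  replace (t - arr_time sigma n) with (1 * t + - arr_time sigma n) in H at 1 by ring.
  apply is_RInt_comp_lin in H. revert H. apply is_RInt_ext.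
  intros x Hx. rewrite Rmin_left, Rmax_right in Hx by assumption.
  unfold glo_profile. rewrite (last_arrival_eq sigma x n), E.
  - unfold scal; simpl; unfold mult; simpl. rewrite !Rmult_1_l. easy.
  - split; [assumption|]. split; [lra|]. intros Hs; specialize (Hn' Hs); lra.
Qed.

(** Ties the recursive bookkeeping of [glo_state] to the actual profile, adding the slots by
    Chasles' relation. *)
Lemma is_RInt_glo_profile (sigma : energy_arrivals) (B : R) (n : nat) :
  arrival sigma n = true ->
  is_RInt (fun s => log2 (1 + glo_profile sigma B s)) 0 (arr_time sigma n)
    (B - snd (glo_state sigma B n)).
Proof.
  induction n as [|n IH]; intros Hn.
  - rewrite arr_time_0. simpl. rewrite Rminus_diag.
    apply (is_RInt_point (V := R_NormedModule)).
  - assert (Hn0 := arrival_le sigma n (S n) ltac:(lia) Hn).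
    assert (Hlt := arr_time_lt sigma n Hn).
    assert (H := is_RInt_glo_profile_slot sigma B n (arr_time sigma (S n)) Hn0
      ltac:(lra) ltac:(lra)).
    specialize (IH Hn0). cbn [glo_state].
    destruct (glo_state sigma B n) as [e b]. simpl in IH |- *.
    assert (HC := is_RInt_Chasles _ _ _ _ _ _ IH H).
    unfold plus in HC; simpl in HC.
    replace (B - (b - bits_sent (glo_slot_power sigma B n e b)
      (arr_time sigma (S n) - arr_time sigma n)))
      with (B - b + bits_sent (glo_slot_power sigma B n e b)
      (arr_time sigma (S n) - arr_time sigma n)) by ring.
    exact HC.
Qed.

(** * Bounds on the completion time of GLO *)

Lemma glo_time_le (sigma : energy_arrivals) (B t : R) :
  0 <= t -> bits_sent (glo_profile sigma B) t = B -> Rbar_le (glo_time sigma B) t.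
Proof.
  intros Ht HB. unfold glo_time, completion_time.
  now apply (proj1 (Glb_Rbar_correct (fun T => 0 <= T /\ bits_sent _ T = B))).
Qed.

(** As [C] precedes the next arrival, a plan made at arrival [n] to finish by [C] is carried out
    without interruption; if no bits remain, GLO has finished by that arrival. *)
Lemma glo_time_le_slot (sigma : energy_arrivals) (B C : R) (n : nat) :
  0 < B -> is_last_arrival sigma C n -> glo_started sigma B n = true ->
  (let (e, b) := glo_state sigma B n in
   0 < b -> arr_time sigma n + lazy_duration e b <= C) ->
  Rbar_le (glo_time sigma B) C.
Proof.
  intros HB (Hn & HnC & Hn') Hs HC.
  assert (Ht := arr_time_nonneg sigma n Hn).
  assert (Hi := glo_state_invariant sigma B n HB Hn).
  assert (Hp := is_RInt_glo_profile sigma B n Hn).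
  assert (Hsl := fun t => is_RInt_glo_profile_slot sigma B n t Hn).
  destruct (glo_state sigma B n) as [e b]. simpl in Hp.
  destruct Hi as (He & Hb & _ & Hi). rewrite Hs in Hi. destruct Hi as [Hbe _].
  destruct (Rle_lt_or_eq_dec 0 b Hb) as [Hb0|<-].
  - specialize (HC Hb0). assert (HD := lazy_duration_nonneg e b).
    apply Rbar_le_trans with (Finite (arr_time sigma n + lazy_duration e b)); [|exact HC].
    apply glo_time_le; [lra|].
    assert (H := Hsl (arr_time sigma n + lazy_duration e b) ltac:(lra)
      ltac:(intros H; specialize (Hn' H); lra)).
    unfold glo_slot_power in H; rewrite Hs in H.
    rewrite Rplus_minus_l in H.
    change (fun s => lazy_power e b s) with (lazy_power e b) in H.
    rewrite bits_sent_lazy_power, Rmin_left in H by lra.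
    destruct (lazy_duration_spec e b He Hb0 Hbe) as [HD0 ED].
    rewrite transmission_eq_efficiency, ED in H by assumption.
    unfold bits_sent. rewrite (is_RInt_unique _ _ _ _ (is_RInt_Chasles _ _ _ _ _ _ Hp H)).
    unfold plus; simpl; ring.
  - apply Rbar_le_trans with (Finite (arr_time sigma n)); [|exact HnC].
    apply glo_time_le; [assumption|].
    unfold bits_sent. rewrite (is_RInt_unique _ _ _ _ Hp). ring.
Qed.

(* Every earlier lazy power is at most the present one, hence more efficient, so
   [B] is at least the whole harvest times the present efficiency; and [B] is at
   most the harvest times the efficiency of spreading it evenly over [T]. *)
Lemma lazy_duration_at_last_arrival (sigma : energy_arrivals) (B T : R) (n : nat) :
  0 < B -> 0 < T -> arrival sigma n = true ->
  B <= T * log2 (1 + total_energy sigma n / T) ->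
  glo_started sigma B n = true /\
  let (e, b) := glo_state sigma B n in 0 < b -> lazy_duration e b <= T.
Proof.
  intros HB HT Hn HBT.
  assert (HS := total_energy_pos sigma n Hn).
  assert (Hi := glo_state_invariant sigma B n HB Hn).
  set (E := total_energy sigma n) in *.
  assert (HET : 0 < E / T) by (apply Rdiv_lt_0_compat; lra).
  rewrite transmission_eq_efficiency in HBT by assumption.
  assert (Hs : glo_started sigma B n = true).
  { assert (H : Rbar_lt B (sendable_bits sigma n)).
    { rewrite sendable_bits_eq by assumption. simpl.
      apply (Rle_lt_trans _ _ _ HBT).
      apply Rmult_lt_compat_l; [assumption|now apply efficiency_lt_inv_ln2]. }
    destruct n; cbn [glo_started]; now destruct (Rbar_lt_dec B _). }
  split; [assumption|].
  destruct (glo_state sigma B n) as [e b].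
  destruct Hi as (He & Hb & HeE & Hi). rewrite Hs in Hi. destruct Hi as [Hbe Hi].
  fold E in HeE, Hi.
  intros Hb0. specialize (Hi Hb0).
  destruct (lazy_duration_spec e b He Hb0 Hbe) as [HD ED].
  set (D := lazy_duration e b) in *.
  assert (HeD : 0 < e / D) by (apply Rdiv_lt_0_compat; lra).
  (* The invariant plus [b = e * efficiency (e / D)] gives [E * efficiency (e / D) <= B <= E *
     efficiency (E / T)]. *)
  assert (Hp : E / T <= e / D).
  { apply efficiency_le_inv; [assumption..|]. apply (Rmult_le_reg_l E); lra. }
  apply Rnot_lt_le; intros HTD.
  assert (e / D < e / T).
  { apply Rmult_lt_compat_l; [assumption|].
    apply Rinv_lt_contravar; [apply Rmult_lt_0_compat|]; lra. }
  assert (e / T <= E / T).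
  { apply Rmult_le_compat_r; [apply Rlt_le, Rinv_0_lt_compat|]; lra. }
  lra.
Qed.

(** Induction over the slots: by [lazy_power_step] each arrival leaves the planned completion time
    unchanged or earlier. *)
Lemma glo_deadline_mono (sigma : energy_arrivals) (B C : R) (n m : nat) :
  0 < B -> (n <= m)%nat -> arrival sigma m = true ->
  let on_schedule k :=
    glo_started sigma B k = true /\
    let (e, b) := glo_state sigma B k in
    0 < b -> arr_time sigma k + lazy_duration e b <= C in
  on_schedule n -> on_schedule m.
Proof.
  intros HB Hnm Hm on_schedule Hn. induction Hnm as [|m Hnm IH]; [assumption|].
  assert (Hm0 := arrival_le sigma m (S m) ltac:(lia) Hm).
  destruct (IH Hm0) as [Hs Hc].
  split; [cbn [glo_started]; rewrite Hs; apply Bool.orb_true_r|].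
  assert (Hi := glo_state_invariant sigma B m HB Hm0).
  assert (Hi' := glo_state_invariant sigma B (S m) HB Hm).
  cbn [glo_state] in *. destruct (glo_state sigma B m) as [e b].
  unfold glo_slot_power in *. rewrite Hs in *.
  destruct Hi as (He & Hb & _ & Hi). rewrite Hs in Hi. destruct Hi as [Hbe _].
  assert (Hlt := arr_time_lt sigma m Hm).
  intros Hb'.
  destruct (Rle_lt_or_eq_dec 0 b Hb) as [Hb0|<-].
  - specialize (Hc Hb0).
    destruct (lazy_power_step e b (arr_time sigma (S m) - arr_time sigma m)
      (arr_energy sigma (S m)) He Hb0 Hbe) as (_ & _ & _ & _ & Hstep);
      [lra|now apply arr_energy_pos|].
    destruct (Hstep Hb') as (_ & Hle & _).
    change (fun s => lazy_power e b s) with (lazy_power e b). lra.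
  (* With no bits left the slot sends none, so the next state has none left either. *)
  - exfalso. revert Hb'. unfold bits_sent.
    rewrite (RInt_ext _ (fun _ => 0)).
    + rewrite RInt_const; unfold scal; simpl; unfold mult; simpl. lra.
    + intros s _. unfold lazy_power. destruct (Rlt_dec 0 0); [lra|].
      apply log2_1_plus_0.
Qed.

Lemma glo_time_le_feasible (sigma : energy_arrivals) (B T : R) (P : R -> R) :
  0 < B -> feasible sigma P -> 0 <= T -> bits_sent P T = B ->
  Rbar_le (glo_time sigma B) (2 * T).
Proof.
  intros HB [HP Hf] HT0 HPT.
  assert (HT : 0 < T).
  { destruct HT0 as [|<-]; [assumption|]. exfalso. revert HPT.
    unfold bits_sent. rewrite RInt_point. unfold zero; simpl. lra. }
  destruct (exists_last_arrival sigma T HT0) as [n Hn].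
  (* The duration bound is obtained at [n], the last arrival by [T]; the deadline [2 * T] is then
     carried to [m], whose slot contains it. *)
  destruct (exists_last_arrival sigma (2 * T) ltac:(lra)) as [m Hm].
  assert (Hfeas := Hf T HT0). rewrite (harvested_eq sigma T n Hn) in Hfeas.
  destruct Hn as (Hn & HnT & _).
  assert (Hnm : (n <= m)%nat) by (apply (is_last_arrival_max sigma (2 * T)); [..|lra]; easy).
  assert (HBT := bits_sent_le P T _ HP HT (total_energy_pos sigma n Hn) Hfeas).
  rewrite HPT in HBT.
  destruct (lazy_duration_at_last_arrival sigma B T n HB HT Hn HBT) as [Hs HD].
  destruct (glo_deadline_mono sigma B (2 * T) n m HB Hnm (proj1 Hm)) as [Hsm Hcm].
  - split; [assumption|]. destruct (glo_state sigma B n) as [e b].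
    intros Hb; specialize (HD Hb); lra.
  - now apply (glo_time_le_slot sigma B (2 * T) m).
Qed.

(** * Passage to the infimum over feasible profiles *)

(** Handles an infimum [y] that may not be attained: were [2 * y < x] with [x] finite, the choice
    [l = x / 2] would be contradictory. *)
Lemma Rbar_le_double (x : Rbar) (y : Rbar) :
  Rbar_le 0 y -> Rbar_lt y p_infty ->
  (forall l : R, Rbar_lt y l -> exists T : R, T < l /\ Rbar_le x (2 * T)) ->
  Rbar_le x (Rbar_mult 2 y).
Proof.
  destruct y as [y| |]; simpl; try easy. intros _ _ H.
  destruct x as [x| |]; simpl in *; [|destruct (H (y + 1) ltac:(lra)); easy|easy].
  apply Rnot_lt_le; intros Hlt.
  destruct (H (x / 2) ltac:(lra)) as [T [HT HxT]]. lra.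
Qed.

Lemma Glb_Rbar_lt (A : R -> Prop) (l : R) :
  Rbar_lt (Glb_Rbar A) l -> exists x, A x /\ x < l.
Proof.
  intros H. apply NNPP; intros Hn.
  apply (Rbar_lt_not_le _ _ H). apply Glb_Rbar_correct.
  intros x Hx. simpl. apply Rnot_lt_le. intros Hlt. apply Hn; now exists x.
Qed.

Theorem theorem3 :
  forall (B : R), 0 < B ->
  forall (sigma : energy_arrivals),
    Rbar_lt (offline_time sigma B) p_infty ->
    Rbar_le (glo_time sigma B) (Rbar_mult (Finite 2) (offline_time sigma B)).
Proof.
  intros B HB sigma Hfin. apply Rbar_le_double; [|exact Hfin|].
  - apply Glb_Rbar_correct. intros T (P & _ & HT). rewrite <- HT.
    apply Glb_Rbar_correct. intros x [Hx _]. exact Hx.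
  (* Two nested infima are unpacked: a profile with completion time below [l], then an actual time
     [T'] below [l] at which it has sent [B] bits. *)
  - intros l Hl. destruct (Glb_Rbar_lt _ _ Hl) as (T & (P & HP & HT) & HTl).
    destruct (Glb_Rbar_lt (fun T => 0 <= T /\ bits_sent P T = B) l) as (T' & [HT' HPT'] & Hl').
    + change (Rbar_lt (completion_time P B) l). rewrite HT. exact HTl.
    + exists T'. split; [exact Hl'|]. now apply (glo_time_le_feasible sigma B T' P).
Qed.
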